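(* Let $\alpha \in \mathbb{R}$ be a quadratic irrational. For each integer $k \geq 1$ let $\mu_k$ be the probability measure on $\mathbb{T} = \mathbb{R}/\mathbb{Z}$ that is the distribution after $k$ steps of the unbiased random walk on $\mathbb{T}$ started at $0$ in which each step is $+\alpha$ or $-\alpha$ (mod $1$), independently and with probability $1/2$ each; equivalently, $\mu_k$ is the $k$-fold convolution $\mu * \cdots * \mu$ of $\mu = \frac12 \delta_{\alpha} + \frac12 \delta_{-\alpha}$. Then there exists a constant $C_\alpha > 0$ depending only on $\alpha$ such that for all integers $k \geq 1$ $$ W_2(\mu_k, dx) \leq C_{\alpha}\, k^{-1/4}.$$
   Context: Here $dx$ is the normalized Lebesgue (Haar) probability measure on $\mathbb{T} = \mathbb{R}/\mathbb{Z} \cong [0,1]$. For probability measures $\mu,\nu$ on $\mathbb{T}$, the $2$-Wasserstein distance is $$ W_2(\mu,\nu) = \left( \inf_{\gamma \in \Gamma(\mu,\nu)} \int_{\mathbb{T}\times\mathbb{T}} |x-y|^2 \, d\gamma(x,y) \right)^{1/2},$$ where $|x-y|$ is the usual distance on the torus and $\Gamma(\mu,\nu)$ is the set of all measures on $\mathbb{T}\times\mathbb{T}$ with marginals $\mu$ and $\nu$. *)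

(* Defs.v *)
From HB Require Import structures.
From mathcomp Require Import all_boot all_order all_algebra.
From mathcomp Require Import lra.
From mathcomp Require Import all_classical all_reals all_analysis.
From mathcomp Require Import measurable_realfun.

Set Implicit Arguments.
Unset Strict Implicit.
Unset Printing Implicit Defensive.

Import Order.TTheory GRing.Theory Num.Theory.
Import numFieldNormedType.Exports.

Local Open Scope classical_set_scope.
Local Open Scope ring_scope.

(* The circle group R/Z, each class being represented by its unique element in
   [0, 1). *)
Record torus (R : realType) := Torus { trep : R ; _ : 0 <= trep < 1 }.

HB.instance Definition _ (R : realType) := [isSub for @trep R].
HB.instance Definition _ (R : realType) := [Choice of torus R by <:].

Section TorusGroup.
Context {R : realType}.
Implicit Types (x y : R) (s t u : torus R).

Lemma fracr_itv x : 0 <= x - (Num.floor x)%:~R < 1.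
Proof.
by have := floor_itv x; rewrite intrD subr_ge0 ltrBlDl => /andP[-> ->].
Qed.

(* the quotient map R -> R/Z *)
Definition toT x : torus R := Torus (fracr_itv x).

Lemma trepK : cancel (@trep R) toT.
Proof.
move=> t; apply: val_inj => /=; have := valP t => /= t01.
by rewrite (@floor_def _ _ 0) ?subr0// add0r.
Qed.

Lemma toTDz x (n : int) : toT (x + n%:~R) = toT x.
Proof.
apply: val_inj => /=; rewrite floorDrz ?intr_int// intrKfloor intrD.
lra.
Qed.

Lemma toTDl x y : toT (trep (toT x) + y) = toT (x + y).
Proof. by rewrite -[RHS](toTDz _ (- Num.floor x)) mulrNz addrAC. Qed.

Lemma toTDr x y : toT (x + trep (toT y)) = toT (x + y).
Proof. by rewrite addrC toTDl addrC. Qed.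

Definition addT s t : torus R := toT (trep s + trep t).
Definition oppT s : torus R := toT (- trep s).

Let addTA : associative addT.
Proof. by move=> s t u; rewrite /addT toTDl toTDr addrA. Qed.

Let addTC : commutative addT.
Proof. by move=> s t; rewrite /addT addrC. Qed.

Let add0T : left_id (toT 0) addT.
Proof. by move=> t; rewrite /addT toTDl add0r trepK. Qed.

Let addNT : left_inverse (toT 0) oppT addT.
Proof. by move=> t; rewrite /addT /oppT toTDl addNr. Qed.

HB.instance Definition _ :=
  GRing.isZmodule.Build (torus R) addTA addTC add0T addNT.
HB.instance Definition _ := isPointed.Build (torus R) 0.

Lemma toT_is_zmod_morphism : zmod_morphism toT.
Proof.
move=> x y; rewrite -[RHS]/(toT (trep (toT x) + trep (toT (- trep (toT y))))).
rewrite toTDr toTDl -[LHS](toTDz _ (Num.floor y)) /=; congr toT; lra.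
Qed.

HB.instance Definition _ :=
  GRing.isZmodMorphism.Build R (torus R) toT toT_is_zmod_morphism.

End TorusGroup.

(* Borel sets of R/Z: those corresponding to Borel subsets of [0, 1). *)
HB.instance Definition _ (R : realType) :=
  Measurable.copy (torus R) (g_sigma_algebra_preimageType (@trep R)).

Lemma measurable_trep (R : realType) : measurable_fun [set: torus R] (@trep R).
Proof. by move=> _ B mB; exists B. Qed.

Lemma measurable_toT (R : realType) :
  @measurable_fun _ _ (measurableTypeR R) (torus R) setT (@toT R).
Proof.
have mfloor : measurable_fun [set: R] (fun x : R => (Num.floor x)%:~R : R).
  by apply: nondecreasing_measurable => // x y xy; rewrite ler_int le_floor.
have mfrac : measurable_fun [set: R] (fun x : R => x - (Num.floor x)%:~R).
  exact: measurable_funB.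
by move=> mT _ [B mB <-]; rewrite [X in _ `&` _ @^-1` X]setTI; exact: mfrac.
Qed.

Definition pair_addT (R : realType) (z : torus R * torus R) : torus R :=
  z.1 + z.2.

Lemma measurable_pair_addT (R : realType) :
  measurable_fun [set: torus R * torus R] (@pair_addT R).
Proof.
apply: (measurableT_comp (@measurable_toT R)).
apply: measurable_funD; apply: (measurableT_comp (@measurable_trep R)).
  exact: measurable_fst.
exact: measurable_snd.
Qed.

Definition toT_mfun (R : realType) : {mfun measurableTypeR R >-> torus R} :=
  @mfun_Sub _ _ (measurableTypeR R) (torus R) _ (mem_set (@measurable_toT R)).

HB.instance Definition _ (R : realType) :=
  isMeasurableFun.Build _ _ _ _ (@pair_addT R) (@measurable_pair_addT R).

(* the distance from trep s - trep t to the nearest integer *)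
Definition distT (R : realType) (s t : torus R) : R :=
  inf [set `|trep s - trep t + n%:~R| | n in [set: int]].

Lemma distTE (R : realType) (s t : torus R) :
  distT s t = Num.min `|trep s - trep t| (1 - `|trep s - trep t|).
Proof.
rewrite /distT; set d := trep s - trep t.
have := valP s; have := valP t => /= /andP[t0 t1] /andP[s0 s1].
have d1 : `|d| < 1 by rewrite ltr_norml /d; lra.
apply/eqP; rewrite eq_le; apply/andP; split.
  have lb : has_lbound [set `|d + n%:~R| | n in [set: int]].
    by exists 0 => _ [n _ <-].
  rewrite le_min; apply/andP; split.
    by apply: ge_inf => //; exists 0 => //; rewrite addr0.
  have [d0|d0] := leP 0 d.
    rewrite ger0_norm//; apply: ge_inf => //; exists (-1) => //.
    rewrite ler0_norm ?mulrN1z; move: d1; rewrite ger0_norm//; lra.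
  rewrite ltr0_norm//; apply: ge_inf => //; exists 1 => //.
  rewrite ger0_norm; move: d1; rewrite ltr0_norm//; lra.
apply: lb_le_inf; first by exists `|d|, 0 => //; rewrite addr0.
move=> _ [n _ <-]; rewrite ge_min.
have [->|n0] := eqVneq n 0; first by rewrite addr0 lexx.
apply/orP; right.
have : 1 <= `|n%:~R : R|.
  by rewrite -intr_norm -[1]/(1%:~R) ler_int; move: n0; case: n => [[]|].
have := ler_normD (d + n%:~R) (- d).
rewrite normrN addrC addKr; lra.
Qed.

(* Haar probability measure: the image of Lebesgue measure on [0, 1] *)
Definition haarT (R : realType) : probability (torus R) R :=
  distribution (uniform_prob (@ltr01 R)) (@toT_mfun R).

Definition convolve (R : realType) (mu nu : probability (torus R) R) :
    probability (torus R) R :=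
  distribution (mu \x nu)%E (@pair_addT R).

Definition half (R : realType) : {nonneg R} := (2^-1)%:nng.

Definition step (R : realType) (a : torus R) : set (torus R) -> \bar R :=
  measure_add (mscale (half R) \d_a) (mscale (half R) \d_(- a)).

Section StepProbability.
Context {R : realType} (a : torus R).

HB.instance Definition _ := Measure.on (step a).

Let step_setT : step a [set: torus R] = 1%E.
Proof.
have hT b : mscale (half R) \d_b [set: torus R] = (2^-1)%:E.
  by rewrite /mscale /= diracT mule1.
rewrite /step measure_addE -[LHS]/(mscale (half R) \d_a setT +
  mscale (half R) \d_(- a)%R setT)%E (hT a) (hT (- a)) -EFinD.
by congr (_%:E); lra.
Qed.

HB.instance Definition _ :=
  Measure_isProbability.Build _ _ _ (step a) step_setT.

End StepProbability.

(* law of the k-th position of the walk, i.e. the k-fold convolution of step a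
   (with k = 0 giving the unit mass at the starting point 0) *)
Definition walk (R : realType) (a : torus R) (k : nat) :
    probability (torus R) R :=
  iter k (fun nu => convolve nu (step a)) \d_(0 : torus R).

Definition couplings (R : realType) (mu nu : probability (torus R) R) :
    set {measure set (torus R * torus R) -> \bar R} :=
  [set g | (forall A, measurable A -> pushforward g fst A = mu A) /\
           (forall A, measurable A -> pushforward g snd A = nu A)].

Definition W2 (R : realType) (mu nu : probability (torus R) R) : \bar R :=
  (ereal_inf [set \int[g]_z (distT z.1 z.2 ^+ 2)%:E | g in couplings mu nu]
     `^ 2^-1)%E.

Definition quadratic_irrational (R : realType) (a : R) : Prop :=
  irrational a /\ exists p q r : int,
    p != 0 /\ p%:~R * a ^+ 2 + q%:~R * a + r%:~R = 0.

(* Main.v *)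
Require Import Defs.
From mathcomp Require Import all_boot all_order all_algebra.
From mathcomp Require Import zify lra ring.
From mathcomp Require Import all_classical all_reals all_analysis.
From mathcomp Require Import measurable_realfun.

(** The law of the walk after [k] steps gives mass [C(k, i) / 2 ^ k] to the
    point [- k alpha + i b], where [b = 2 alpha]: it is the binomial law carried
    by an orbit of the rotation by [b].  The binomial weights are symmetric and
    unimodal, so cutting their graph into horizontal layers writes this law as
    a combination, with nonnegative coefficients, of counting measures of orbit
    segments [t <= i <= k - t] ([binomial_layer_cake]).  The coefficients add
    up to the largest weight, the central one, which is at most [k ^ (- 1/2)]
    ([central_bin_le]).

    It is therefore enough that the counting measure of [n] consecutive points
    of an orbit of [b] can be moved to [n] times Haar measure at a total
    quadratic cost bounded independently of [n] ([transportable_orbit]): then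
    the squared distance is at most a constant times [k ^ (- 1/2)], and taking
    the square root gives the exponent [- 1/4].

    The uniform bound is where the arithmetic of [alpha] enters.  A quadratic
    irrational is badly approximable (Liouville), and so is its double.
    Dirichlet's theorem thus provides a fraction [p / q] in lowest terms with
    [n / M <= q <= n] and [|q b - p| <= 1 / n].  Along [q] steps the orbit stays
    within [1 / q] of the orbit of the rotation by [p / q], which visits each
    class of the lattice of step [1 / q] once; assigning to each of the [q]
    points its own arc of length [1 / q] moves mass by at most [2 / q], for a
    total cost [q (2 / q) ^ 2 = 4 / q <= 4 M / n].  The [n - q] remaining points
    form an orbit segment shorter by a fixed proportion; the lengths [n] of the
    successive segments decay geometrically down to [1], so that the sum of the
    costs [4 M / n] is bounded. *)

Set Implicit Arguments.
Unset Strict Implicit.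
Unset Printing Implicit Defensive.

Import Order.TTheory GRing.Theory Num.Theory.
Import numFieldNormedType.Exports.

Local Open Scope classical_set_scope.
Local Open Scope ring_scope.

(** * Transport with controlled quadratic cost *)

Section Transport.
Context {R : realType}.
Local Notation T := (torus R).
Implicit Types (mu nu : set T -> R) (e : R) (A : set T).

Lemma distT_ge0 (s t : T) : 0 <= distT s t.
Proof.
apply: lb_le_inf; first by exists `|trep s - trep t + 0%:~R|, 0.
by move=> _ [n _ <-].
Qed.

Lemma distT_toT_le (x y : R) (n : int) :
  distT (toT x) (toT y) <= `|x - y + n%:~R|.
Proof.
apply: ge_inf; first by exists 0 => _ [m _ <-].
exists (n + Num.floor x - Num.floor y) => //=.
by rewrite !intrD mulrNz; congr `|_|; lra.
Qed.

Lemma measurable_distT2 :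
  measurable_fun setT (fun z : T * T => (distT z.1 z.2 ^+ 2)%:E).
Proof.
apply/measurable_EFinP/measurable_funX.
under eq_fun do rewrite distTE.
have m1 : measurable_fun setT (fun z : T * T => `|trep z.1 - trep z.2|).
  apply: measurableT_comp => //; apply: measurable_funB;
    apply: (measurableT_comp (@measurable_trep R)).
    exact: measurable_fst.
  exact: measurable_snd.
by apply: measurable_minr => //; apply: measurable_funB.
Qed.

(** Neither mass is normalised: [e] bounds the total cost of a plan, so that
    plans and costs add up and scale together with the measures.  The
    marginals are real-valued set functions, prescribed on measurable sets
    only, to keep the bookkeeping of finite combinations inside [R]. *)
Definition transportable mu nu e :=
  exists g : {measure set (T * T) -> \bar R},
    [/\ forall A, measurable A -> g (fst @^-1` A) = (mu A)%:E,
        forall A, measurable A -> g (snd @^-1` A) = (nu A)%:E &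
        (\int[g]_z (distT z.1 z.2 ^+ 2)%:E <= e%:E)%E].

Lemma eq_transportable mu mu' nu nu' e e' :
  (forall A, measurable A -> mu A = mu' A) ->
  (forall A, measurable A -> nu A = nu' A) -> e <= e' ->
  transportable mu nu e -> transportable mu' nu' e'.
Proof.
move=> eqmu eqnu ee' [g [g1 g2 ge]]; exists g; split.
- by move=> A mA; rewrite g1// eqmu.
- by move=> A mA; rewrite g2// eqnu.
- by rewrite (le_trans ge)// lee_fin.
Qed.

Lemma transportable0 : transportable (fun=> 0) (fun=> 0) 0.
Proof. by exists mzero; split=> //; rewrite integral_measure_zero. Qed.

Lemma transportableD mu1 nu1 e1 mu2 nu2 e2 :
  transportable mu1 nu1 e1 -> transportable mu2 nu2 e2 ->
  transportable (mu1 \+ mu2) (nu1 \+ nu2) (e1 + e2).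
Proof.
move=> [g [g1 g2 ge]] [h [h1 h2 he]]; exists (measure_add g h); split.
- by move=> A mA; rewrite [LHS]measure_addE g1// h1.
- by move=> A mA; rewrite [LHS]measure_addE g2// h2.
- rewrite ge0_integral_measure_add//; last 2 first.
  + by move=> z _; rewrite lee_fin sqr_ge0.
  + exact: measurable_distT2.
  by rewrite EFinD leeD.
Qed.

Lemma transportableZ (c : R) mu nu e : 0 <= c ->
  transportable mu nu e ->
  transportable (fun A => c * mu A) (fun A => c * nu A) (c * e).
Proof.
move=> c0 [g [g1 g2 ge]]; exists (mscale (NngNum c0) g); split.
- by move=> A mA; rewrite -[LHS]/(c%:E * g (fst @^-1` A))%E g1.
- by move=> A mA; rewrite -[LHS]/(c%:E * g (snd @^-1` A))%E g2.
- rewrite ge0_integral_mscale//; last 2 first.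
  + exact: measurable_distT2.
  + by move=> z _; rewrite lee_fin sqr_ge0.
  by rewrite EFinM lee_wpmul2l.
Qed.

Lemma transportable_sum n (mu nu : nat -> set T -> R) (e : nat -> R) :
  (forall i, (i < n)%N -> transportable (mu i) (nu i) (e i)) ->
  transportable (fun A => \sum_(i < n) mu i A) (fun A => \sum_(i < n) nu i A)
    (\sum_(i < n) e i).
Proof.
elim: n => [_|n IHn tr].
  by apply: eq_transportable transportable0 => [A _|A _|]; rewrite big_ord0.
have := transportableD (IHn (fun i ni => tr i (ltnW ni))) (tr n (ltnSn n)).
by apply: eq_transportable => [A _|A _|]; rewrite big_ord_recr.
Qed.

Definition haar (A : set T) : R := fine (haarT R A).

Lemma haarT_fin A : measurable A -> haarT R A = (haar A)%:E.
Proof. by move=> mA; rewrite fineK// fin_num_measure. Qed.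

(** The plan is the image of Haar measure under [t |-> (f t, t)]: mass travels
    from Haar measure along [f], so that the second marginal is right by
    construction. *)
Lemma transportable_map (f : T -> T) (D : R) : measurable_fun setT f ->
  (forall t, distT (f t) t <= D) ->
  transportable (fun A => haar (f @^-1` A)) haar (D ^+ 2).
Proof.
move=> mf fD.
have mp : measurable_fun setT (fun t : T => (f t, t)).
  by apply: measurable_fun_pair.
pose p : {mfun T >-> (T * T)%type} := mfun_Sub (mem_set mp).
exists (distribution (haarT R) p); split.
- move=> A mA; rewrite -[LHS]/(haarT R (f @^-1` A)) -haarT_fin//.
  by rewrite -[X in measurable X]setTI; exact: mf.
- by move=> A mA; rewrite -[LHS]/(haarT R A) -haarT_fin.
- rewrite (ge0_integral_pushforward mp)//; last 2 first.
  + exact: measurable_distT2.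
  + by move=> z _; rewrite lee_fin sqr_ge0.
  rewrite preimage_setT.
  have -> : (D ^+ 2)%:E = (\int[haarT R]_t cst (D ^+ 2)%:E t)%E.
    rewrite integral_cst// -[RHS]/((D ^+ 2)%:E * haarT R [set: T])%E.
    by rewrite [X in (_ * X)%E]probability_setT mule1.
  apply: ge0_le_integral => //.
  + by move=> t _; rewrite lee_fin sqr_ge0.
  + exact: (measurableT_comp measurable_distT2 mp).
  + move=> t _; rewrite lee_fin /= lerXn2r// nnegrE ?distT_ge0//.
    exact: le_trans (distT_ge0 _ _) (fD t).
Qed.

Definition arc (q i : nat) : set T :=
  [set t | i%:R <= q%:R * trep t < i.+1%:R].

Lemma measurable_arc q i : measurable (arc q i).
Proof.
have -> : arc q i =
    setT `&` (fun t : T => q%:R * trep t) @^-1` `[i%:R, i.+1%:R[%classic.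
  by rewrite setTI; apply/seteqP; split => t /=; rewrite in_itv.
have : measurable_fun setT (fun t : T => q%:R * trep t).
  by apply: measurable_funM => //; exact: measurable_trep.
by apply => //; exact: measurable_itv.
Qed.

(** The identification of the circle with [[0, 1]] under [uniform_prob] covers
    the class of [0] twice; the endpoint [1] is negligible and is discarded
    first, so that the arc becomes a plain interval. *)
Lemma haar_arc q i : (i < q)%N -> haar (arc q i) = q%:R^-1.
Proof.
move=> iq.
have q0 : 0 < q%:R :> R by rewrite ltr0n (leq_ltn_trans _ iq).
have mtA : measurable ((@toT R) @^-1` arc q i : set (measurableTypeR R)).
  by rewrite -[X in measurable X]setTI; apply: (@measurable_toT R) => //;
     exact: measurable_arc.
rewrite /haar.
have -> : haarT R (arc q i) =
    uniform_prob (@ltr01 R) ((@toT R) @^-1` arc q i) by [].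
rewrite -[X in uniform_prob _ X]setIT -integral_indic// integral_uniform//=.
- rewrite subr0 invr1 mul1e.
  rewrite -integral_itv_bndo_bndc; last first.
    apply: measurable_funTS; apply/measurable_EFinP; exact: measurable_indic.
  pose I : set R := `[i%:R / q%:R, i.+1%:R / q%:R[%classic.
  transitivity (fine (\int[@lebesgue_measure R]_(x in `[0%R, 1%R[)
      (\1_I x)%:E)).
    congr fine; apply: eq_integral => x; rewrite inE /= in_itv /= => x01.
    rewrite !indicE; congr (_%:R%:E); congr (nat_of_bool _).
    have xx : x - (Num.floor x)%:~R = x.
      by rewrite (@floor_def _ _ 0) ?subr0// add0r.
    apply: asbool_equiv_eq.
    rewrite /arc /I /= in_itv /= xx ler_pdivrMr// ltr_pdivlMr//.
    by rewrite mulrC.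
  rewrite integral_indic//=.
  rewrite setIidl; last first.
    move=> x; rewrite /I /= !in_itv /= => /andP[x1 x2]; apply/andP; split.
      by rewrite (le_trans _ x1)// divr_ge0 ?ler0n.
    by rewrite (lt_le_trans x2)// ler_pdivrMr// mul1r ler_nat.
  rewrite lebesgue_measure_itv /= lte_fin ltr_pM2r ?invr_gt0// ltr_nat ltnSn.
  by rewrite -EFinB -mulrBl -natrB// subSnn mul1r.
- exact: measurable_itv.
- apply/measurable_EFinP; exact: measurable_indic.
Qed.

(** Haar measure pushed to equal masses at [q] points: the map is constant on
    each of the [q] arcs, hence the preimage of any set is a union of arcs. *)
Lemma haar_step_map q (y : nat -> T) :
  (0 < q)%N ->
  let f t := y (Num.truncn (q%:R * trep t)) in
  measurable_fun setT f /\
  forall A, haar (f @^-1` A) = q%:R^-1 * \sum_(i < q) \1_A (y i).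
Proof.
move=> q0 f.
pose F A i := if y i \in A then arc q i else set0.
have mF A i : measurable (F A i).
  by rewrite /F; case: ifP => _; [exact: measurable_arc|exact: measurable0].
have arcP t i : arc q i t -> Num.truncn (q%:R * trep t) = i.
  exact: truncn_def.
have fA A : f @^-1` A = \big[setU/set0]_(i < q) F A i.
  rewrite -bigcup_mkord; apply/seteqP; split => t /=.
    move=> Aft; exists (Num.truncn (q%:R * trep t)).
      have /andP[t0 t1] := valP t.
      rewrite /= truncn_lt_nat; last by rewrite mulr_ge0.
      by rewrite gtr_pMr// ltr0n.
    rewrite /F mem_set//.
    by have := valP t => /andP[t0 t1]; apply: truncn_itv; rewrite mulr_ge0.
  move=> [i iq]; rewrite /F; case: ifPn => // /set_mem Ayi /arcP ti.
  by rewrite /f ti.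
split=> [_ A mA|A]; first by rewrite setTI fA; exact: bigsetU_measurable.
rewrite /haar fA measure_semi_additive_ord_I//; last 2 first.
- apply/trivIsetP => i j _ _ /eqP ij; apply/seteqP; split => // t [].
  rewrite /F; case: ifP => // _; case: ifP => // _ /arcP ti /arcP tj.
  by apply: ij; rewrite -ti -tj.
- exact: bigsetU_measurable.
rewrite (eq_bigr (fun i : 'I_q => (q%:R^-1 * \1_A (y i))%:E)) => [|i _].
  by rewrite sumEFin mulr_sumr.
rewrite indicE /F; case: ifPn => _; last by rewrite measure0 mulr0.
by rewrite mulr1 -(haar_arc (ltn_ord i)) -haarT_fin//; exact: measurable_arc.
Qed.
End Transport.

(** * Diophantine approximation *)

Section Diophantine.
Context {R : realType}.
Implicit Types b : R.

Definition badly_approximable b (M : R) :=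
  forall (q : nat) (p : int), (0 < q)%N ->
    1 <= M * q%:R * `|q%:R * b - p%:~R|.

(** Liouville's argument.  If [f] is the quadratic polynomial killing [a], then
    [N = q ^ 2 f (p / q)] is a nonzero integer, hence of size at least [1], and
    it factors as the product of [p - q a] and a term of size [O(q)] as soon as
    [|q a - p| <= 1]; otherwise the bound is trivial.  The integer [N] cannot
    vanish: [a] would be [p / q], or the other root of [f] would be [p / q] and
    [a] would be rational because the sum of the roots is. *)
Lemma quadratic_irrational_badly_approximable (a : R) :
  quadratic_irrational a -> exists2 M : R, 0 < M & badly_approximable a M.
Proof.
move=> [irr_a [P [Q [S [P0 fa0]]]]].
exists (1 + `|P%:~R| * (2 * `|a| + 1) + `|Q%:~R|) => [|q p q0].
  by rewrite -addrA ltr_wpDr// addr_ge0// mulr_ge0// addr_ge0// mulr_ge0.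
have qR0 : 0 < q%:R :> R by rewrite ltr0n.
have q1 : 1 <= q%:R :> R by rewrite ler1n.
set u : R := P%:~R; set v : R := Q%:~R; set d := q%:R * a - p%:~R.
have u0 : u != 0 by rewrite intr_eq0.
pose N : int := P * p ^+ 2 + Q * p * q%:Z + S * q%:Z ^+ 2.
have NE : N%:~R = - d * (u * (p%:~R + q%:R * a) + v * q%:R) :> R.
  rewrite /N !expr2 !(intrD, intrM) -/u -/v.
  have -> : S%:~R = - (u * a ^+ 2 + v * a) :> R.
    by apply/eqP; rewrite -addr_eq0 addrC fa0.
  by rewrite /d -[(q%:Z)%:~R]/(q%:R); ring.
have aNrat (x : rat) : a <> ratr x by move=> ax; apply: irr_a; exists x.
have N0 : N != 0.
  rewrite -(intr_eq0 R) NE mulf_neq0 ?oppr_eq0//.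
    apply/eqP => /eqP; rewrite subr_eq0 => /eqP qa.
    apply: (aNrat (p%:Q / q%:Q)); rewrite fmorph_div /= !ratr_int -qa.
    by rewrite mulrC mulKf// gt_eqF.
  apply/eqP => vu0.
  apply: (aNrat (- (Q%:Q / P%:Q) - p%:Q / q%:Q)).
  rewrite rmorphB rmorphN /= !fmorph_div /= !ratr_int -/u -/v.
  have -> : p%:~R = - (v * q%:R) / u - q%:R * a :> R.
    apply: (mulfI u0); rewrite mulrBr mulrCA mulfV// mulr1.
    move/eqP: vu0; rewrite mulrDr; lra.
  rewrite -[(q%:Z)%:~R]/(q%:R : R).
  by field; rewrite u0 gt_eqF.
have [d1|/ltW d1] := leP 1 `|d|.
  rewrite -[leLHS](mulr1 1) ler_pM// -[leLHS](mulr1 1) ler_pM//.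
  by rewrite -addrA lerDl addr_ge0// mulr_ge0// addr_ge0// mulr_ge0.
have N1 : 1 <= `|N%:~R : R|.
  rewrite -intr_norm -[1]/(1%:~R) ler_int.
  by move: N0; case: (N) => [[]|].
apply: (le_trans N1); rewrite NE normrM normrN mulrC.
rewrite ler_wpM2r//.
have -> : u * (p%:~R + q%:R * a) + v * q%:R =
    (u * (2 * a) + v) * q%:R - u * d by rewrite /d; ring.
apply: (le_trans (ler_normB _ _)); rewrite !normrM (ger0_norm (ltW qR0)).
have h1 : `|u * (2 * a) + v| <= `|u| * (2 * `|a|) + `|v|.
  apply: (le_trans (ler_normD _ _)).
  by rewrite !normrM (ger0_norm (ler0n _ 2)).
have h2 := ler_wpM2l (normr_ge0 u) d1.
have h3 := ler_wpM2l (normr_ge0 u) q1.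
have := ler_wpM2r (ltW qR0) h1; lra.
Qed.

(** The pigeonhole principle for the fractional parts of [0, b, ..., N b] in
    [N] bins.  The last clause expresses that [p / q] is in lowest terms in the
    form needed to see that [j |-> j p] is injective modulo [q]; it comes
    from taking [q] minimal, since [m p = s q] would make [s / m] at least as
    good an approximation. *)
Lemma dirichlet_approximation b (N : nat) : (0 < N)%N ->
  exists (q : nat) (p : int),
    [/\ (0 < q <= N)%N, `|q%:R * b - p%:~R| <= N%:R^-1 &
        forall m : nat, (0 < m < q)%N -> ~~ (q%:Z %| m%:Z * p)%Z].
Proof.
move=> N0; have NR0 : 0 < N%:R :> R by rewrite ltr0n.
pose good (q : nat) :=
  (0 < q)%N /\ exists p : int, `|q%:R * b - p%:~R| <= N%:R^-1.
have [q0 q0N gq0] : exists2 q, (q <= N)%N & good q.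
  pose fr (j : nat) : R := j%:R * b - (Num.floor (j%:R * b))%:~R.
  have fr01 j : 0 <= fr j < 1 by exact: fracr_itv.
  have frN j : (Num.truncn (N%:R * fr j) < N)%N.
    have /andP[f0 f1] := fr01 j; rewrite truncn_lt_nat ?mulr_ge0//.
    by rewrite gtr_pMr.
  pose bin (j : 'I_N.+1) := Ordinal (frN j).
  have /injectivePn [i [j ij bij]] : ~~ injectiveb bin.
    apply/negP => /injectiveP /leq_card; by rewrite !card_ord ltnn.
  wlog {ij} ij : i j bij / (i < j)%N.
    move=> W; have [lt_ij|lt_ji|/val_inj e] := ltngtP i j.
    - exact: (W i j).
    - exact: (W j i).
    - by rewrite e eqxx in ij.
  exists (j - i)%N; first by rewrite (leq_trans (leq_subr _ _))// -ltnS.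
  split; first by rewrite subn_gt0.
  exists (Num.floor (j%:R * b) - Num.floor (i%:R * b)).
  have /(congr1 val) /= eb := bij.
  have Hi : 0 <= N%:R * fr i by have /andP[f0 _] := fr01 i; rewrite mulr_ge0.
  have Hj : 0 <= N%:R * fr j by have /andP[f0 _] := fr01 j; rewrite mulr_ge0.
  have /andP[i1 i2] := truncn_itv Hi; have /andP[j1 j2] := truncn_itv Hj.
  rewrite -eb -natr1 in j1 j2; rewrite -natr1 in i2.
  rewrite natrB ?(ltnW ij)// intrB.
  have -> : (j%:R - i%:R) * b -
      ((Num.floor (j%:R * b))%:~R - (Num.floor (i%:R * b))%:~R) = fr j - fr i.
    by rewrite /fr; ring.
  rewrite -[leRHS]mul1r ler_pdivlMr// -[X in _ * X](ger0_norm (ltW NR0)).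
  by rewrite -normrM ler_norml; lra.
have exq : exists q, `[< good q >] by exists q0; apply/asboolP.
case: (ex_minnP exq) => q /asboolP [q_gt0 [p qp]] qmin.
exists q, p; split=> //.
  by rewrite q_gt0 (leq_trans _ q0N)// qmin//; apply/asboolP.
move=> m /andP[m0 mq]; apply/negP => /dvdzP [s ms].
have /qmin : `[< good m >].
  apply/asboolP; split=> //; exists s.
  have qR0 : 0 < q%:R :> R by rewrite ltr0n.
  have msR : m%:R * p%:~R = s%:~R * q%:R :> R.
    by have := congr1 (fun z : int => z%:~R : R) ms; rewrite !intrM.
  have -> : m%:R * b - s%:~R = m%:R / q%:R * (q%:R * b - p%:~R).
    have -> : s%:~R = m%:R * p%:~R / q%:R :> R.
      by rewrite msR mulfK// gt_eqF.
    by field; rewrite gt_eqF.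
  rewrite normrM (le_trans _ qp)// ler_piMl//.
  by rewrite ger0_norm// ler_pdivrMr// mul1r ler_nat ltnW.
by rewrite leqNgt mq.
Qed.
End Diophantine.

(** * Transporting orbit segments to Haar measure *)

Section Orbits.
Context {R : realType}.
Local Notation T := (torus R).

(** The point of index [j] is assigned the arc numbered
    [floor (q x) + j p] modulo [q].  Each point of that arc lies within [2 / q]
    of [x + j b]: rounding [q x] and the position inside the arc account for
    one arc length, and the drift [j |b - p / q|] for another. *)
Lemma transportable_resonant_orbit (b : R) (q : nat) (p : int) (x : R) :
  (0 < q)%N -> `|q%:R * b - p%:~R| <= q%:R^-1 ->
  (forall m : nat, (0 < m < q)%N -> ~~ (q%:Z %| m%:Z * p)%Z) ->
  transportable (fun A => \sum_(j < q) \1_A (toT (x + j%:R * b)))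
    (fun A => q%:R * haar A) (4 / q%:R).
Proof.
move=> q0 qbp qp.
have qR0 : 0 < q%:R :> R by rewrite ltr0n.
have qZ0 : q%:Z != 0 by rewrite eqz_nat -lt0n.
pose c := Num.floor (q%:R * x).
have cellP (j : nat) : (`|((c + j%:Z * p) %% q)%Z| < q)%N.
  by rewrite -ltz_nat gez0_abs ?modz_ge0// ltz_pmod.
pose cell (j : 'I_q) := Ordinal (cellP j).
have cell_inj : injective cell.
  move=> i j; wlog ij : i j / (i <= j)%N => [W|].
    by have [/W//|/ltnW /W W' /esym/W' ->] := leqP i j.
  move=> /(congr1 val) /= /(congr1 Posz).
  rewrite !gez0_abs ?modz_ge0// => /eqP; rewrite eq_sym eqz_mod_dvd.
  have -> : c + j%:Z * p - (c + i%:Z * p) = (j - i)%N%:Z * p.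
    by rewrite -subzn//; ring.
  move=> dvd; apply/val_inj/eqP; rewrite /= eqn_leq ij leqNgt.
  apply/negP => ltij.
  have /qp : (0 < j - i < q)%N.
    by rewrite subn_gt0 ltij (leq_ltn_trans (leq_subr _ _)).
  by rewrite dvd.
(* the default value 0 is only taken at indices i >= q, which carry no arc *)
pose point (i : nat) : T :=
  if insub i is Some i' then toT (x + (invF cell_inj i')%:R * b) else 0.
have [mf fE] := haar_step_map point q0.
have := transportable_map (D := 2 / q%:R) mf.
set f := (fun t : T => _).
move=> tr; apply: eq_transportable (transportableZ (ltW qR0) (tr _)).
- move=> A _; rewrite fE mulrA mulfV ?gt_eqF// mul1r.
  rewrite (reindex_inj cell_inj) /=; apply: eq_bigr => j _.
  rewrite /point (_ : insub _ = Some (cell j)) ?invF_f//.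
  exact: (valK (cell j)).
- by [].
- suff -> : q%:R * (2 / q%:R) ^+ 2 = 4 / q%:R :> R by [].
  by field; rewrite gt_eqF.
- move=> t; rewrite /f /point.
  have /andP[t0 t1] := valP t.
  have qt0 : 0 <= q%:R * trep t by rewrite mulr_ge0.
  have /andP[i0 i1] := truncn_itv qt0.
  set i := Num.truncn _ in i0 i1 *.
  have iq : (i < q)%N by rewrite truncn_lt_nat// gtr_pMr.
  rewrite insubT; set i' := Sub _ _; set j := invF _ _.
  have /(congr1 val) /= /(congr1 Posz) : cell j = i' by exact: f_invF.
  rewrite gez0_abs ?modz_ge0// => ji.
  have := divz_eq (c + j%:Z * p) q; set s := ((_ %/ _)%Z); rewrite ji => cs.
  have csR : c%:~R + j%:R * p%:~R = s%:~R * q%:R + i%:R :> R.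
    by have := congr1 (fun z : int => z%:~R : R) cs; rewrite !intrD !intrM.
  rewrite -{1}(trepK t); apply: (le_trans (distT_toT_le _ _ (- s))).
  rewrite ler_pdivlMr// mulrC -[X in X * _](ger0_norm (ltW qR0)) -normrM.
  have -> : q%:R * (x + j%:R * b - trep t + (- s)%:~R) =
     (q%:R * x - c%:~R) + j%:R * (q%:R * b - p%:~R) - (q%:R * trep t - i%:R).
    have -> : i%:R = c%:~R + j%:R * p%:~R - s%:~R * q%:R :> R.
      by rewrite csR; ring.
    by rewrite mulrNz; ring.
  have /andP[c0 c1] := fracr_itv (q%:R * x).
  have : `|j%:R * (q%:R * b - p%:~R)| <= 1.
    rewrite normrM ger0_norm//; apply: (le_trans (ler_wpM2l _ qbp)) => //.
    by rewrite ler_pdivrMr// mul1r ler_nat ltnW.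
  rewrite !ler_norml -/c in c0 c1 *; rewrite -natr1 in i1; lra.
Qed.

(** A bounded cost, written with a slack [1 / (n + 1)] that lets the induction
    absorb the cost [4 / q] of the first [q] points: passing from [n] to
    [n - q] frees [8 M ^ 2 q / ((n - q + 1) (n + 1))], which is at least
    [4 / q] because [n <= M q]. *)
Lemma transportable_orbit (b M : R) : 0 < M -> badly_approximable b M ->
  forall (n : nat) (x : R),
  transportable (fun A => \sum_(j < n) \1_A (toT (x + j%:R * b)))
    (fun A => n%:R * haar A) (8 * M ^+ 2 * (1 - n.+1%:R^-1)).
Proof.
move=> M0 bM; elim/ltn_ind => n IHn x.
have [->|n0] := posnP n.
  apply: eq_transportable transportable0 => [A _|A _|].
  - by rewrite big_ord0.
  - by rewrite mul0r.
  - by rewrite invr1 subrr mulr0.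
have [q [p [/andP[q0 qn] qbp qp]]] := dirichlet_approximation b n0.
have nR0 : 0 < n%:R :> R by rewrite ltr0n.
have qR0 : 0 < q%:R :> R by rewrite ltr0n.
have nMq : n%:R <= M * q%:R.
  have := le_trans (bM q p q0) (ler_wpM2l (ltW (mulr_gt0 M0 qR0)) qbp).
  by rewrite ler_pdivlMr// mul1r.
have chunk : transportable (fun A => \sum_(j < q) \1_A (toT (x + j%:R * b)))
    (fun A => q%:R * haar A) (4 / q%:R).
  apply: (transportable_resonant_orbit (p := p)) => //.
  by rewrite (le_trans qbp)// lef_pV2 ?posrE// ler_nat.
have rest : (n - q < n)%N by rewrite ltn_subrL q0.
have := transportableD chunk (IHn _ rest (x + q%:R * b)).
apply: eq_transportable => [A _|A _|] /=.
- rewrite -[in RHS](subnKC qn) big_split_ord /=; congr (_ + _).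
  by apply: eq_bigr => j _; rewrite natrD mulrDl addrA.
- by rewrite natrB// -mulrDl addrC subrK.
- have q1 : 1 <= q%:R :> R by rewrite ler1n.
  have qnR : q%:R <= n%:R :> R by rewrite ler_nat.
  rewrite -[n.+1%:R]natr1 -[(n - q).+1%:R]natr1 natrB//.
  set r : R := n%:R - q%:R + 1; have r0 : 0 < r by rewrite /r; lra.
  have n10 : 0 < n%:R + 1 :> R by lra.
  rewrite -subr_ge0.
  have -> : 8 * M ^+ 2 * (1 - (n%:R + 1)^-1) -
      (4 / q%:R + 8 * M ^+ 2 * (1 - r^-1)) =
    4 * (2 * (M * q%:R) ^+ 2 - r * (n%:R + 1)) / (q%:R * r * (n%:R + 1)).
    rewrite /r; field; rewrite !gt_eqF//.
  apply: divr_ge0; last by rewrite !mulr_ge0// ltW.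
  rewrite mulr_ge0// subr_ge0.
  have rn : r <= n%:R by rewrite /r; lra.
  have n12 : n%:R + 1 <= 2 * n%:R :> R by lra.
  apply: (le_trans (ler_pM (ltW r0) (ltW n10) rn n12)).
  have := ler_pM (ltW nR0) (ltW nR0) nMq nMq; rewrite expr2; lra.
Qed.
End Orbits.

(** * Binomial weights *)

Section Binomial.

Lemma leq_bin_succ (k t : nat) :
  (t.+1 <= k - t)%N -> ('C(k, t) <= 'C(k, t.+1))%N.
Proof.
by move=> tk; rewrite -(leq_pmul2l (ltn0Sn t)) mul_bin_left leq_mul2r tk orbT.
Qed.

Lemma bin_double_succ (m : nat) : 'C(m.*2.+1, m.+1) = 'C(m.*2.+1, m).
Proof.
have le : (m <= m.*2.+1)%N by rewrite -addnn leqW// leq_addr.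
by rewrite -(bin_sub le) -addnn subSn ?leq_addr// addnK.
Qed.

Lemma central_binS (m : nat) : 'C(m.*2.+2, m.+1) = (2 * 'C(m.*2.+1, m))%N.
Proof. by rewrite binS bin_double_succ addnn mul2n. Qed.

(** The exact factor [2 m + 1] makes the induction close, because
    [(2 m + 1) (2 m + 3) <= 4 (m + 1) ^ 2]. *)
Lemma leq_central_bin2 (m : nat) : (m.*2.+1 * 'C(m.*2, m) ^ 2 <= 16 ^ m)%N.
Proof.
elim: m => // m IHm.
have diag : (m.+1 * 'C(m.*2.+2, m.+1) = 2 * m.*2.+1 * 'C(m.*2, m))%N.
  rewrite central_binS -bin_double_succ mulnCA.
  by rewrite -(mul_bin_diag m.*2.+1 m) mulnA.
rewrite doubleS -2!(leq_pmul2l (ltn0Sn m)) (expnS 16).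
have -> : (m.+1 * (m.+1 * (m.*2.+3 * 'C(m.*2.+2, m.+1) ^ 2)) =
    m.*2.+3 * (m.+1 * 'C(m.*2.+2, m.+1)) ^ 2)%N by ring.
rewrite diag -mul2n in IHm *.
have le : ((2 * m).+1 * (2 * m).+3 <= 4 * m.+1 ^ 2)%N.
  by rewrite -mulnn; lia.
move: IHm; set c := 'C(_, _); set p := (16 ^ m)%N => IHm.
have -> : ((2 * m).+3 * (2 * (2 * m).+1 * c) ^ 2 =
   4 * (((2 * m).+1 * (2 * m).+3) * ((2 * m).+1 * c ^ 2)))%N by ring.
have -> : (m.+1 * (m.+1 * (16 * p)) = 4 * (4 * m.+1 ^ 2 * p))%N by ring.
by rewrite leq_pmul2l// leq_mul.
Qed.

Lemma leq_central_bin (k : nat) : (k.+1 * 'C(k, k./2) ^ 2 <= 4 ^ k)%N.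
Proof.
have pow4 m : (4 ^ m.*2 = 16 ^ m)%N by rewrite -mul2n expnM.
rewrite -{1 2 4}(odd_double_half k); case: (odd k) => /=; last first.
  by rewrite add0n pow4; exact: leq_central_bin2.
(* for odd k, C(k, k./2) is half of the next central coefficient *)
rewrite add1n; set m := k./2.
have := leq_central_bin2 m.+1; rewrite doubleS central_binS.
by rewrite !expnS -pow4; nia.
Qed.

Context {R : realType}.

Lemma sum_pascal (k : nat) (f : nat -> R) :
  \sum_(i < k.+2) 'C(k.+1, i)%:R * f i =
  \sum_(i < k.+1) 'C(k, i)%:R * f i.+1 + \sum_(i < k.+1) 'C(k, i)%:R * f i.
Proof.
rewrite big_ord_recl /= bin0 [X in _ = _ + X]big_ord_recl /= bin0.
rewrite addrCA; congr (_ + _).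
under eq_bigr do rewrite /bump leq0n add1n binS natrD mulrDl.
rewrite big_split /= addrC; congr (_ + _).
by rewrite big_ord_recr /= bin_small// mul0r addr0.
Qed.

(** The thickness of the [t]-th horizontal layer of the graph of [C(k, _)]. *)
Definition bin_jump (k t : nat) : R :=
  if t is s.+1 then 'C(k, t)%:R - 'C(k, s)%:R else 1.

Lemma bin_jump_ge0 (k t : nat) : (t <= k./2)%N -> 0 <= bin_jump k t.
Proof.
case: t => [|t] //= tk; rewrite subr_ge0 ler_nat leq_bin_succ//; lia.
Qed.

Lemma sum_bin_jump (k m : nat) : \sum_(t < m.+1) bin_jump k t = 'C(k, m)%:R.
Proof.
elim: m => [|m IHm]; first by rewrite big_ord1 bin0.
by rewrite big_ord_recr /= IHm addrC subrK.
Qed.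

(** By symmetry and telescoping, [C(k, i)] is the sum of the jumps
    [bin_jump k t] for [t <= min i (k - i)]; exchanging the sums groups, for
    each height [t], the indices [t <= i <= k - t]. *)
Lemma binomial_layer_cake (k : nat) (f : nat -> R) :
  \sum_(i < k.+1) 'C(k, i)%:R * f i =
  \sum_(t < k./2.+1) bin_jump k t * \sum_(j < k.+1 - t.*2) f (t + j)%N.
Proof.
transitivity (\sum_(i < k.+1) \sum_(t < k./2.+1)
    if (t < (minn i (k - i)).+1)%N then bin_jump k t * f i else 0).
  apply: eq_bigr => i _; rewrite -big_mkcond /=.
  have ik : (i <= k)%N by rewrite -ltnS.
  rewrite -(big_ord_widen_cond _ xpredT (fun t => bin_jump k t * f i)) /=.
    rewrite -mulr_suml sum_bin_jump; congr (_%:R * _).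
    by case: leqP => // _; rewrite bin_sub.
  by rewrite ltnS; lia.
rewrite exchange_big /=; apply: eq_bigr => t _.
have tk : (t.*2 <= k)%N by have := ltn_ord t; lia.
have kE : k.+1 = (t + ((k.+1 - t.*2) + t))%N by lia.
rewrite [in LHS]kE !big_split_ord /= big1 => [|i _]; last first.
  by case: ifP => //; have := ltn_ord i; lia.
rewrite add0r [X in _ + X]big1 => [|i _]; last first.
  by case: ifP => //; have := ltn_ord i; lia.
rewrite addr0 mulr_sumr; apply: eq_bigr => i _.
by case: ifP => //; have := ltn_ord i; lia.
Qed.

Lemma central_bin_le (k : nat) : (0 < k)%N ->
  'C(k, k./2)%:R / 2 ^+ k <= k%:R `^ (- 2^-1) :> R.
Proof.
move=> k0; have kR0 : 0 < k%:R :> R by rewrite ltr0n.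
rewrite powRN powR12_sqrt; last exact: ltW.
rewrite ler_pdivrMr ?exprn_gt0// mulrC ler_pdivlMr ?sqrtr_gt0//.
rewrite -(@ler_pXn2r _ 2)// ?nnegrE ?mulr_ge0 ?sqrtr_ge0 ?exprn_ge0//.
rewrite exprMn sqr_sqrtr ?(ltW kR0)//.
have -> : (2 ^+ k) ^+ 2 = (4 ^ k)%:R :> R.
  by rewrite exprAC natrX; congr (_ ^+ _); rewrite expr2 -natrM.
rewrite -natrX -natrM ler_nat (leq_trans _ (leq_central_bin k))//.
by rewrite mulnC leq_mul2r leqnSn orbT.
Qed.

End Binomial.

(** * The law of the walk *)

Section Walk.
Context {R : realType}.
Local Notation T := (torus R).

Lemma step_indic (a : T) (B : set T) :
  step a B = (2^-1 * (\1_B a + \1_B (- a)))%:E.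
Proof.
by rewrite /step measure_addE mulrDr EFinD.
Qed.

Lemma measurable_translation (a : T) : measurable_fun setT (fun x : T => x + a).
Proof.
apply: (measurableT_comp (@measurable_pair_addT R) (g := fun x : T => (x, a))).
by apply: measurable_fun_pair.
Qed.

Lemma convolve_step (nu : probability T R) (a : T) (A : set T) : measurable A ->
  convolve nu (step a) A =
  ((2^-1)%:E * (nu ((fun x : T => (x + a)%R) @^-1` A) +
               nu ((fun x : T => (x - a)%R) @^-1` A)))%E.
Proof.
move=> mA.
have msh b : measurable ((fun x : T => x + b) @^-1` A).
  by rewrite -[X in measurable X]setTI; apply: (measurable_translation b).
transitivity (\int[nu]_x ((2^-1)%:E *
    ((\1_((fun x : T => x + a) @^-1` A) x)%:E +
     (\1_((fun x : T => x - a) @^-1` A) x)%:E)))%E.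
  apply: eq_integral => x _ /=.
  rewrite step_indic.
  rewrite EFinM EFinD; congr (_ * (_ + _))%E; rewrite !indicE;
    congr (_%:R%:E); by rewrite mem_xsection.
have mI b : measurable_fun setT
    (fun x : T => (\1_((fun x : T => x + b) @^-1` A) x)%:E).
  by apply/measurable_EFinP; exact: measurable_indic.
rewrite ge0_integralZl_EFin//; last 2 first.
- by move=> x _; rewrite adde_ge0// lee_fin.
- exact: emeasurable_funD.
congr (_ * _)%E; rewrite ge0_integralD//.
by rewrite !integral_indic// !setIT.
Qed.

(** The position after [i] steps [+ a] and [k - i] steps [- a]. *)
Definition walk_point (a : R) (k i : nat) : T :=
  toT (- (k%:R * a) + i%:R * (2 * a)).

Lemma walk_binomial (a : R) (k : nat) (A : set T) : measurable A ->
  walk (toT a) k A =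
  ((\sum_(i < k.+1) 'C(k, i)%:R * \1_A (walk_point a k i)) / 2 ^+ k)%:E.
Proof.
elim: k A => [|k IHk] A mA.
  rewrite big_ord1 bin0 mul1r expr0 divr1 /walk_point !mul0r oppr0 addr0.
  by rewrite [LHS]diracE indicE raddf0.
rewrite [LHS]convolve_step// !IHk; last 2 first.
- by rewrite -[X in measurable X]setTI;
    apply: (measurable_translation (- toT a)).
- by rewrite -[X in measurable X]setTI;
    apply: (measurable_translation (toT a)).
rewrite -EFinD -EFinM (sum_pascal k (fun i => \1_A (walk_point a k.+1 i))).
rewrite -mulrDl exprS invfM; congr EFin; rewrite [RHS]mulrCA.
congr (_ * ((_ + _) / _)); apply: eq_bigr => i _; congr (_ * _).
  rewrite !indicE; have -> : walk_point a k.+1 i.+1 = walk_point a k i + toT a.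
    by rewrite /walk_point -raddfD -!natr1; congr toT; ring.
  by [].
rewrite !indicE; have -> : walk_point a k.+1 i = walk_point a k i - toT a.
  by rewrite /walk_point -raddfB -!natr1; congr toT; ring.
by [].
Qed.

Lemma W2_le (mu : probability T R) (m : set T -> R) (e : R) :
  (forall A, measurable A -> mu A = (m A)%:E) ->
  transportable m haar e -> (W2 mu (haarT R) <= (e `^ 2^-1)%:E)%E.
Proof.
move=> muE [g [g1 g2 ge]]; rewrite /W2 -poweR_EFin.
apply: gt0_ler_poweR => //.
- rewrite in_itv /= leey andbT.
  by apply: le_ereal_inf_tmp => _ [h _ <-]; apply: integral_ge0 => z _;
    rewrite lee_fin sqr_ge0.
- rewrite in_itv /= leey andbT (le_trans _ ge)//.
  by apply: integral_ge0 => z _; rewrite lee_fin sqr_ge0.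
- apply: ge_ereal_inf; exists (\int[g]_z (distT z.1 z.2 ^+ 2)%:E)%E => //.
  exists g => //.
  split=> A mA; first by rewrite [LHS]g1// muE.
  by rewrite [LHS]g2// haarT_fin.
Qed.

(** Each layer of the binomial weights is an orbit segment of the rotation by
    [2 a], transported at cost at most [8 M ^ 2] whatever its length; the
    layers have total thickness [C(k, k./2)]. *)
Lemma transportable_walk (a M : R) : 0 < M -> badly_approximable (2 * a) M ->
  forall k, transportable
    (fun A => (\sum_(i < k.+1) 'C(k, i)%:R * \1_A (walk_point a k i)) / 2 ^+ k)
    haar (8 * M ^+ 2 * 'C(k, k./2)%:R / 2 ^+ k).
Proof.
move=> M0 aM k.
have k2 : 0 < 2 ^+ k :> R by rewrite exprn_gt0.
pose x t : R := - (k%:R * a) + t%:R * (2 * a).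
have block (t : nat) : (t < k./2.+1)%N ->
    transportable
      (fun A => bin_jump k t * \sum_(j < k.+1 - t.*2)
         \1_A (toT (x t + j%:R * (2 * a))))
      (fun A => bin_jump k t * ((k.+1 - t.*2)%:R * haar A))
      (bin_jump k t * (8 * M ^+ 2)).
  move=> tk; apply: transportableZ; first exact: bin_jump_ge0.
  apply: eq_transportable (transportable_orbit M0 aM _ _) => //.
  by rewrite ler_piMr ?mulr_ge0// ltW.
have k20 : 0 <= (2 ^+ k)^-1 :> R by rewrite invr_ge0 ltW.
have := transportableZ k20 (transportable_sum block).
apply: eq_transportable => [A _|A _|].
- rewrite mulrC (binomial_layer_cake k (fun i => \1_A (walk_point a k i))).
  congr (_ / _); apply: eq_bigr => t _; congr (_ * _); apply: eq_bigr => j _.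
  by congr (\1_A (toT _)); rewrite /x natrD; ring.
- under eq_bigr do rewrite mulrA.
  rewrite -mulr_suml mulrA.
  have -> : \sum_(t < k./2.+1) bin_jump k t * (k.+1 - t.*2)%:R = 2 ^+ k :> R.
    (* comparing total masses amounts to the case f = 1 of the layer cake *)
    have := binomial_layer_cake k (fun=> 1 : R).
    under eq_bigr do rewrite mulr1.
    under [X in _ = X -> _]eq_bigr do rewrite sumr_const card_ord.
    move=> <-.
    by rewrite -natr_sum -(natrX _ 2 k) -[2%N]/(1 + 1)%N expnDn; congr (_%:R);
      apply: eq_bigr => i _; rewrite !exp1n !muln1.
  by rewrite mulVf ?gt_eqF// mul1r.
- by rewrite -mulr_suml sum_bin_jump; lra.
Qed.

End Walk.

(** * The convergence rate *)

Theorem theorem4 (R : realType) (alpha : R) (halpha : quadratic_irrational alpha) :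
  exists C : R, 0 < C /\
    forall k : nat, (1 <= k)%N ->
      (W2 (walk (toT alpha) k) (haarT R) <= (C * k%:R `^ (- 4^-1))%:E)%E.
Proof.
have [M M0 aM] := quadratic_irrational_badly_approximable halpha.
have M20 : 0 < 2 * M by rewrite mulr_gt0.
have a2M : badly_approximable (2 * alpha) (2 * M).
  move=> q p q0; have := aM (q * 2)%N p; rewrite muln_gt0 q0 => /(_ isT).
  rewrite natrM (_ : M * (q%:R * 2) = 2 * M * q%:R); last by ring.
  by rewrite -(mulrA q%:R 2 alpha).
pose K : R := 8 * (2 * M) ^+ 2.
have K0 : 0 < K by rewrite mulr_gt0// exprn_gt0.
exists (K `^ 2^-1); split=> [|k k0]; first exact: powR_gt0.
have tr := transportable_walk M20 a2M k.
apply: (le_trans (W2_le (walk_binomial alpha k) tr)).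
rewrite lee_fin -/K.
have -> : k%:R `^ (- 4^-1) = (k%:R `^ (- 2^-1)) `^ 2^-1 :> R.
  by rewrite -powRrM; congr (_ `^ _); lra.
rewrite -powRM ?powR_ge0// ?(ltW K0)//.
apply: ge0_ler_powR; rewrite ?nnegrE//.
- by rewrite divr_ge0// mulr_ge0 ?(ltW K0).
- by rewrite mulr_ge0 ?powR_ge0 ?(ltW K0).
- by rewrite -mulrA ler_wpM2l ?(ltW K0)// central_bin_le.
Qed.
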